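(* For all integers $m,n\geq 9$ with $m\equiv 3\pmod 6$ and $n\equiv 3\pmod 6$, there exists a semi-cyclic $2$-BSEC$(n,m,3,1)$.
   Context: For $(x,y)\in Z_n\times Z_m$, the points $(x-1,y),(x+1,y),(x,y-1),(x,y+1)$ (first coordinate mod $n$, second mod $m$) are called $2$-contiguous to $(x,y)$. A $2$-BSEC$(n,m,k,1)$ (two-dimensional balanced sampling plan excluding contiguous units) is a pair $(X,\mathcal B)$ with $X=Z_n\times Z_m$ and $\mathcal B$ a collection of $k$-subsets of $X$ (blocks) such that no two $2$-contiguous points lie together in a block, while any two distinct points that are not $2$-contiguous lie together in exactly one block. It is semi-cyclic if $\mathcal B$ is invariant under the permutation $(x,y)\mapsto(x,y+1 \bmod m)$. *)

(* Defs.v *)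
From HB Require Import structures.
From mathcomp Require Import all_boot all_order all_algebra.

Set Implicit Arguments.
Unset Strict Implicit.
Unset Printing Implicit Defensive.

Import GRing.Theory.
Local Open Scope ring_scope.

(* 'Z_n is the ring of integers mod n only when 1 < n, so the definitions
   below are meaningful only when 1 < n and 1 < m. *)
Definition point (n m : nat) : finType := ('Z_n * 'Z_m)%type.

Definition contiguous2 (n m : nat) (p q : point n m) : bool :=
  [|| q == (p.1 - 1, p.2), q == (p.1 + 1, p.2),
      q == (p.1, p.2 - 1) | q == (p.1, p.2 + 1)].

(* A set of blocks suffices for lambda = 1 and k >= 2: a repeated block would
   cover each of its pairs of points more than once. *)
Definition BSEC2 (n m k : nat) (BB : {set {set point n m}}) : Prop :=
  [/\ forall B, B \in BB -> #|B| = k,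
      forall p q : point n m, contiguous2 p q ->
        forall B, B \in BB -> ~ (p \in B /\ q \in B)
    & forall p q : point n m, p != q -> ~~ contiguous2 p q ->
        exists! B : {set point n m}, [/\ B \in BB, p \in B & q \in B]].

Definition shift2 (n m : nat) (p : point n m) : point n m := (p.1, p.2 + 1).

Definition semi_cyclic (n m : nat) (BB : {set {set point n m}}) : Prop :=
  [set [set shift2 p | p in B] | B : {set point n m} in BB] = BB.

(* Main.v *)
Require Import Defs.
From HB Require Import structures.
From mathcomp Require Import all_boot all_order all_algebra zify ring.

(** A design with block size three is the same thing as a third-point operation
    on its compatible pairs. On two points of the same row [{x} * Z_m] use a
    cyclic triple system on [Z_m] covering all differences except 0, 1 and -1;
    on two points of the same column use such a system on [Z_n]. What remains
    are the pairs differing in both coordinates: take a Steiner triple system on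
    [Z_n] and, for each of its triples [{x, y, z}] with [z] the largest label,
    the blocks [{(x, c - d), (z, c), (y, c + d)}] with [d != 0]. As [m] is odd,
    every nonzero vertical difference occurs exactly once between any two of the
    three rows.

    Cyclic systems on [Z_(6 t + 3)] come from Langford-type sequences: [t]
    triples [x, y, x + y] that cover [2, ..., 3 t + 1] up to sign; the Steiner triple
    system is Bose's. *)

Set Implicit Arguments.
Unset Strict Implicit.
Unset Printing Implicit Defensive.

Import GRing.Theory.

(** * Langford-type sequences *)

(* Whether [d] is, up to sign mod [v], one of [tr.1], [tr.2], [tr.1 + tr.2];
   only the last needs the negative sign. *)
Definition covers (v : nat) (tr : nat * nat) (d : nat) : bool :=
  [|| d == tr.1, d == tr.2, d == tr.1 + tr.2 | tr.1 + tr.2 + d == v].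

(* Nested arcs: [i < l] joins position [p + i] to position [p + a - i], the
   positions being shifted by the offset [o]. *)
Definition nest (o a l p : nat) : seq (nat * nat) :=
  [seq (a - i.*2, o + p + i) | i <- iota 0 l].

Lemma size_nest o a l p : size (nest o a l p) = l.
Proof. by rewrite size_map size_iota. Qed.

Lemma nest_covers v o a l p i d : i < l -> covers v (a - i.*2, o + p + i) d ->
  has (covers v ^~ d) (nest o a l p).
Proof.
move=> lt_il Hd; apply/hasP; exists (a - i.*2, o + p + i) => //.
by apply/mapP; exists i; rewrite // mem_iota.
Qed.

Lemma nest_covers_diff v o a l p d :
  d <= a -> a < d + l.*2 -> odd a = odd d -> has (covers v ^~ d) (nest o a l p).
Proof.
move=> *; apply: (@nest_covers v o a l p ((a - d)./2)); first by lia.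
by rewrite /covers /=; apply/or4P/Or41/eqP; lia.
Qed.

Lemma nest_covers_left v o a l p d :
  o + p <= d < o + p + l -> has (covers v ^~ d) (nest o a l p).
Proof.
move=> *; apply: (@nest_covers v o a l p (d - (o + p))); first by lia.
by rewrite /covers /=; apply/or4P/Or42/eqP; lia.
Qed.

Lemma nest_covers_right v o a l p d :
  l.*2 <= a.+1 -> o + p + a < d + l -> d <= o + p + a ->
  has (covers v ^~ d) (nest o a l p).
Proof.
move=> *; apply: (@nest_covers v o a l p (o + p + a - d)); first by lia.
by rewrite /covers /=; apply/or4P/Or43/eqP; lia.
Qed.

Lemma nest_covers_hook v o a l p d :
  0 < l -> o + p + a + d = v -> has (covers v ^~ d) (nest o a l p).
Proof.
move=> *; apply: (@nest_covers v o a l p 0); first by lia.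
by rewrite /covers /=; apply/or4P/Or44/eqP; lia.
Qed.

(** An entry [(a, l, p)] encodes [l] nested arcs, the outermost of length [a] and starting at
    position [p]. *)
Definition nests (o : nat) (s : seq (nat * nat * nat)) : seq (nat * nat) :=
  flatten [seq nest o c.1.1 c.1.2 c.2 | c <- s].

Lemma nests_cons o a l p s :
  nests o ((a, l, p) :: s) = nest o a l p ++ nests o s.
Proof. by []. Qed.

Lemma size_nests o s : size (nests o s) = sumn [seq c.1.2 | c <- s].
Proof.
by elim: s => //= -[[a l] p] s IH; rewrite nests_cons size_cat size_nest IH.
Qed.

(** Covering is enough: [t] triples offer [3 t] values up to sign for [3 t] targets, so uniqueness
    will follow by counting. *)
Definition langford_like (t : nat) (L : seq (nat * nat)) : Prop :=
  size L = t /\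
  forall d, 2 <= d <= (3 * t).+1 -> has (covers (6 * t + 3) ^~ d) L.

Ltac in_nest :=
  first [ by apply: nest_covers_diff; lia | by apply: nest_covers_left; lia
        | by apply: nest_covers_right; lia | by apply: nest_covers_hook; lia ].

Ltac in_nests :=
  rewrite ?nests_cons ?has_cat;
  repeat (apply/orP; first [by left; in_nest | right]).

Ltac cuts d bs :=
  lazymatch bs with
  | (?b :: ?bs')%list => case: (leqP d b) => ?; [by in_nests | cuts d bs']
  | _ => by in_nests
  end.

(* The arcs below were found by computer search for patterns linear in [s]. For
   [t = 0, 3] mod 4 they form a perfect Langford sequence of defect 2; for
   [t = 1, 2] mod 4 a hooked one, obtained from a perfect sequence of defect 3
   by appending a final arc of length 2, so that the value [3 t + 2] stands for
   [- (3 t + 1)]. *)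
Lemma langford_mod4_0 s (t := 4 * s + 4) : langford_like t (nests t.+1
  [:: (4 * s + 3, s, 1); (4 * s + 5, 1, s + 1); (2 * s + 2, s + 1, s + 2);
      (4 * s + 4, 1, 2 * s + 3); (2 * s + 3, 1, 4 * s + 5); (4 * s + 2, s, 4 * s + 6);
      (2 * s + 1, s, 5 * s + 7)]).
Proof.
split=> [|d /andP[d_ge2]]; first by rewrite size_nests /t /=; lia.
rewrite /t => d_le.
(* Values up to [t + 1] are arc lengths, of constant parity within a nest; larger ones are shifted
   endpoints. The thresholds given to [cuts] split each range into runs handled by a single nest. *)
have [?|?] := leqP d (4 * s + 5); first have [?|?] := boolP (odd d).
- cuts d [:: 2 * s + 1; 2 * s + 3; 4 * s + 3].
- cuts d [:: 2 * s + 2; 4 * s + 2].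
- cuts d [:: 5 * s + 5; 5 * s + 6; 6 * s + 7; 6 * s + 8; 7 * s + 9; 8 * s + 9;
    8 * s + 10; 9 * s + 10; 9 * s + 11; 10 * s + 11; 10 * s + 12; 10 * s + 13;
    11 * s + 13].
Qed.

Lemma langford_mod4_1 s (t := 4 * s + 9) : langford_like t (nests t.+1
  [:: (4 * s + 8, s + 2, 1); (4 * s + 9, 1, s + 3); (2 * s + 3, s + 1, s + 4);
      (4 * s + 10, 1, 2 * s + 5); (4 * s + 7, 1, 2 * s + 6); (2 * s + 4, 1, 4 * s + 10);
      (4 * s + 5, s + 1, 4 * s + 11); (2 * s + 2, s, 5 * s + 13); (2, 1, 8 * s + 17)]).
Proof.
split=> [|d /andP[d_ge2]]; first by rewrite size_nests /t /=; lia.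
rewrite /t => d_le.
have [?|?] := leqP d (4 * s + 10); first have [?|?] := boolP (odd d).
- cuts d [:: 2 * s + 3; 4 * s + 5; 4 * s + 7].
- cuts d [:: 2; 2 * s + 2; 2 * s + 4; 4 * s + 8].
(* The last run is the single value [3 t + 1 = 12 s + 28], reached as minus the right end
   [12 s + 29] of the final arc. *)
- cuts d [:: 5 * s + 12; 5 * s + 13; 6 * s + 14; 6 * s + 15; 6 * s + 16; 7 * s
    + 17; 8 * s + 19; 8 * s + 20; 9 * s + 21; 9 * s + 22; 10 * s + 22; 10 * s +
    23; 10 * s + 24; 10 * s + 25; 11 * s + 25; 12 * s + 26; 12 * s + 27].
Qed.

Lemma langford_mod4_2 s (t := 4 * s + 6) : langford_like t (nests t.+1
  [:: (4 * s + 5, s + 1, 1); (4 * s + 6, 1, s + 2); (2 * s + 2, s, s + 3);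
      (4 * s + 7, 1, 2 * s + 3); (2 * s + 3, 1, 2 * s + 4); (4 * s + 4, 1, 2 * s + 5);
      (4 * s + 2, s, 4 * s + 8); (2 * s + 1, s, 5 * s + 9); (2, 1, 8 * s + 11)]).
Proof.
split=> [|d /andP[d_ge2]]; first by rewrite size_nests /t /=; lia.
rewrite /t => d_le.
have [?|?] := leqP d (4 * s + 7); first have [?|?] := boolP (odd d).
- cuts d [:: 2 * s + 1; 2 * s + 3; 4 * s + 5].
- cuts d [:: 2; 2 * s + 2; 4 * s + 2; 4 * s + 4].
- cuts d [:: 5 * s + 8; 5 * s + 9; 6 * s + 9; 6 * s + 10; 6 * s + 11; 6 * s +
    12; 7 * s + 12; 8 * s + 13; 8 * s + 14; 9 * s + 14; 9 * s + 15; 10 * s +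
    15; 10 * s + 16; 10 * s + 17; 11 * s + 17; 12 * s + 17; 12 * s + 18].
Qed.

Lemma langford_mod4_3 s (t := 4 * s + 3) : langford_like t (nests t.+1
  [:: (4 * s + 2, s, 1); (4 * s + 4, 1, s + 1); (2 * s + 1, s, s + 2);
      (2 * s + 2, 1, 2 * s + 2); (4 * s + 3, 1, 2 * s + 3); (4 * s + 1, s, 4 * s + 5);
      (2 * s, s, 5 * s + 6)]).
Proof.
split=> [|d /andP[d_ge2]]; first by rewrite size_nests /t /=; lia.
rewrite /t => d_le.
have [?|?] := leqP d (4 * s + 4); first have [?|?] := boolP (odd d).
- cuts d [:: 2 * s + 1; 4 * s + 1].
- cuts d [:: 2 * s; 2 * s + 2; 4 * s + 2].
- cuts d [:: 5 * s + 4; 5 * s + 5; 6 * s + 5; 6 * s + 6; 6 * s + 7; 7 * s + 7;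
    8 * s + 7; 8 * s + 8; 9 * s + 8; 9 * s + 9; 10 * s + 9; 10 * s + 10; 11 * s
    + 10].
Qed.

Lemma langford_like_exists t : 0 < t -> exists L, langford_like t L.
Proof.
move=> t_gt0; have [s [r [Et r_lt4]]] : exists s r, t = 4 * s + r /\ r < 4.
  by exists (t %/ 4), (t %% 4); lia.
case: r => [|[|[|[|//]]]] in Et r_lt4.
- case: s => [|s] in Et; first by lia.
  by have := langford_mod4_0 s; rewrite (_ : 4 * s + 4 = t);
    [eexists; eassumption | lia].
- case: s => [|[|s]] in Et.
  (* The values 1, 5 and, below, 2 of [t] precede the range of the general patterns. Here 5 stands
     for -4 mod 9. *)
  + exists [:: (2, 3)]; rewrite Et; split=> // d Hd.
    by rewrite /covers /=; lia.
  + exists [:: (6, 7); (5, 10); (4, 8); (3, 14); (2, 9)].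
    rewrite Et; split=> // d Hd.
    by rewrite /covers /=; lia.
  by have := langford_mod4_1 s; rewrite (_ : 4 * s + 9 = t);
    [eexists; eassumption | lia].
- case: s => [|s] in Et.
  + exists [:: (2, 4); (3, 5)]; rewrite Et; split=> // d Hd.
    by rewrite /covers /=; lia.
  by have := langford_mod4_2 s; rewrite (_ : 4 * s + 6 = t);
    [eexists; eassumption | lia].
- by have := langford_mod4_3 s; rewrite (_ : 4 * s + 3 = t);
    [eexists; eassumption | lia].
Qed.

(** * Cyclic triple systems *)

Local Open Scope ring_scope.

Lemma val_Zp1 v : (1 < v)%N -> (1 : 'Z_v) = 1%N :> nat.
Proof. by move=> v_gt1; rewrite /= modn_small. Qed.

Lemma val_ZpN v (d : 'Z_v) : (1 < v)%N -> - d = ((v - d) %% v)%N :> nat.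
Proof. by move=> v_gt1 /=; move: (nat_of_ord d) => k; rewrite Zp_cast. Qed.

Lemma ltn_Zp v (d : 'Z_v) : (1 < v)%N -> (d < v)%N.
Proof. by move=> v_gt1; rewrite -[X in (_ < X)%N](Zp_cast v_gt1). Qed.

Definition far (v : nat) (d : 'Z_v) : bool := [&& d != 0, d != 1 & d != -1].

Lemma farN v (d : 'Z_v) : far (- d) = far d.
Proof.
by rewrite /far oppr_eq0 eqr_opp eqr_oppLR [(d != -1) && _]andbC.
Qed.

(* [a + f (b - a)] is the third point of the block through [a] and [b]. *)
Definition cyclic_third (v : nat) (f : 'Z_v -> 'Z_v) : Prop :=
  forall d, far d -> [/\ far (f d), f (f d) = d & f (- d) = f d - d].

Lemma card_far v : (2 < v)%N -> #|[set d : 'Z_v | far d]| = (v - 3)%N.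
Proof.
move=> v_gt2; have v_gt1 : (1 < v)%N by lia.
have -> : [set d : 'Z_v | far d] = ~: [set 0; 1; -1].
  by apply/setP=> d; rewrite /far !inE !negb_or andbA.
have cardZ : #|'Z_v| = v by rewrite card_ord Zp_cast.
rewrite cardsCs setCK cardZ -setUA !cardsU1 cards1 !inE.
have n1 : (1 : 'Z_v) != -1.
  apply/eqP => /(congr1 (@nat_of_ord _)).
  by rewrite val_ZpN // val_Zp1 // modn_small; lia.
have n2 : (0 : 'Z_v) != 1 by rewrite eq_sym oner_eq0.
have n3 : (0 : 'Z_v) != -1 by rewrite eq_sym oppr_eq0 oner_eq0.
by rewrite (negbTE n1) (negbTE n2) (negbTE n3).
Qed.

Section CyclicThird.
Variables (t : nat) (L : seq (nat * nat)).
Hypothesis LL : langford_like t L.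
Let v := (6 * t + 3)%N.

Let v_gt1 : (1 < v)%N. Proof. by rewrite /v; lia. Qed.

Let tri (i : 'I_t) : nat * nat := nth (0, 0)%N L i.

(** [option bool] serves as a three-element index set for the sides of the triangle {0, x, x +
    y}. *)
Let edge (i : 'I_t) (k : option bool) : 'Z_v :=
  match k with
  | None => (tri i).1%:R
  | Some true => (tri i).2%:R
  | Some false => ((tri i).1 + (tri i).2)%:R
  end.

Let diff (x : 'I_t * bool * option bool) : 'Z_v :=
  (-1) ^+ x.1.2 * edge x.1.1 x.2.

(* [0], [diff e] and [diff (swap e)] form a translate of [{0, x, x + y}], where
   [(x, y)] is the triple of [e]. *)
Let swap (x : 'I_t * bool * option bool) : 'I_t * bool * option bool :=
  match x.1.2, x.2 with
  | false, None => (x.1.1, false, Some false)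
  | false, Some false => (x.1.1, false, None)
  | true, None => (x.1.1, false, Some true)
  | false, Some true => (x.1.1, true, None)
  | true, Some true => (x.1.1, true, Some false)
  | true, Some false => (x.1.1, true, Some true)
  end.

Let diff_surj d : far d -> exists x, diff x = d.
Proof.
case: LL => sizeL coverL.
have small (e : 'Z_v) : (2 <= e <= (3 * t).+1)%N -> exists x, diff x = e.
  move=> /coverL /(has_nthP (0, 0)%N) [i lt_i ce].
  rewrite sizeL in lt_i; rewrite -[e]natr_Zp.
  case/or4P: ce => /eqP De.
  - by exists (Ordinal lt_i, false, None); rewrite /diff /= mul1r -De.
  - by exists (Ordinal lt_i, false, Some true); rewrite /diff /= mul1r -De.
  - by exists (Ordinal lt_i, false, Some false); rewrite /diff /= mul1r -De.
  exists (Ordinal lt_i, true, Some false); rewrite /diff /= mulN1r.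
  by apply/eqP; rewrite eq_sym -addr_eq0 -natrD addnC De pchar_Zp.
move=> d_far; have [d_small|d_big] := leqP d (3 * t).+1.
  apply: small; rewrite d_small andbT.
  case/and3P: d_far => d0 d1 _.
  have : nat_of_ord d <> 0%N by move=> E; case/eqP: d0; apply: val_inj.
  have : nat_of_ord d <> 1%N.
    by move=> E; case/eqP: d1; apply: val_inj; rewrite /= E modn_small.
  by lia.
(* The representative [v - d] of [- d] is at most [3 t + 1], and at least 2 because [d] is not
   -1. *)
have [x Dx] : exists x, diff x = - d.
  have lt_dv := ltn_Zp d v_gt1.
  have dV : nat_of_ord d <> (v - 1)%N.
    move=> E; case/and3P: d_far => _ _ /eqP; apply; apply: ord_inj.
    by rewrite val_ZpN // val_Zp1 // modn_small; lia.
  apply: small; rewrite val_ZpN // modn_small; last by lia.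
  by move: (nat_of_ord d) d_big lt_dv dV => k; rewrite /v; lia.
exists (x.1.1, ~~ x.1.2, x.2); rewrite -[d]opprK -Dx /diff /=.
by case: x.1.2; rewrite /= ?mul1r ?mulN1r ?opprK.
Qed.

Let card_index : #|[set: 'I_t * bool * option bool]| = (6 * t)%N.
Proof. by rewrite cardsT !card_prod card_option card_bool card_ord; lia. Qed.

Let far_sub : [set d | far d] \subset diff @: setT.
Proof.
by apply/subsetP=> d; rewrite inE => /diff_surj [x <-]; apply: imset_f.
Qed.

Let card_diff : #|[set d : 'Z_v | far d]| = #|[set: 'I_t * bool * option bool]|.
Proof. by rewrite card_index card_far /v; lia. Qed.

(* The 6 t signed differences cover the 6 t far residues, hence are distinct. *)
Let far_diff x : far (diff x).
Proof.
have /eqP eqS : [set d | far d] == diff @: setT.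
  by rewrite eqEcard far_sub card_diff leq_imset_card.
by have := imset_f diff (in_setT x); rewrite -eqS inE.
Qed.

Let diff_inj : injective diff.
Proof.
suff /imset_injP inj : #|diff @: setT| == #|[set: 'I_t * bool * option bool]|.
  by move=> x y; apply: inj; rewrite inE.
by rewrite eqn_leq leq_imset_card -card_diff subset_leq_card.
Qed.

(** Conjugating [swap] by the bijection [diff] onto the far residues gives [f]. It is an involution
    because [swap] is; negating [d] flips the sign bit of its index. *)
Lemma cyclic_third_exists : exists f : 'Z_v -> 'Z_v, cyclic_third f.
Proof.
pose g d := [pick x | diff x == d].
have gK x : g (diff x) = Some x.
  rewrite /g; case: pickP => [y /eqP /diff_inj -> //|/(_ x)].
  by rewrite eqxx.
exists (fun d => if g d is Some x then diff (swap x) else d) => d.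
move=> /diff_surj [x <-].
rewrite gK gK far_diff; split=> //.
  by case: x => [[i []] [[]|]].
have -> : - diff x = diff (x.1.1, ~~ x.1.2, x.2).
  by rewrite /diff /=; case: x.1.2; rewrite /= ?mul1r ?mulN1r ?opprK.
rewrite gK.
by case: x => [[i []] [[]|]]; rewrite /diff /swap /= ?natrD; ring.
Qed.
End CyclicThird.

(** * Steiner triple systems *)

Definition steiner_op (T : eqType) (s : T -> T -> T) : Prop :=
  forall x y, x != y -> [/\ s y x = s x y, s x y != x & s x (s x y) = y].

Lemma half_Zp u : (1 < u)%N -> odd u -> exists h : 'Z_u, h + h = 1.
Proof.
case: u => [//|[//|u]] _ odd_u.
(* The modulus is now [u.+2], so this is half of the modulus plus one. *)
exists (u.+3./2)%:R; rewrite -natrD addnn.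
have -> : (u.+3./2.*2 = u.+2 + 1)%N by lia.
by rewrite natrD pchar_Zp // add0r.
Qed.

Lemma neq_succ v (x : 'Z_v) : (x == x + 1 = false) * (x == x - 1 = false).
Proof.
rewrite ![_ == x + _]eq_sym !(can2_eq (addKr _) (addNKr _)) addNr.
by rewrite oppr_eq0 oner_eq0.
Qed.

Lemma Zp3_cases (k l : 'Z_3) : [\/ l = k, l = k + 1 | k = l + 1].
Proof.
case: k l => [[|[|[|//]]] hk] [[|[|[|//]]] hl];
  first [by apply: Or31; apply: val_inj | by apply: Or32; apply: val_inj
        | by apply: Or33; apply: val_inj].
Qed.

Lemma Zp3_triple (k : 'Z_3) : k + k + k = 0.
Proof. by case: k => [[|[|[|//]]] hk]; apply: val_inj. Qed.

Lemma Zp3_succ2 (k : 'Z_3) : k + 1 + 1 = k - 1.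
Proof. by case: k => [[|[|[|//]]] hk]; apply: val_inj. Qed.

(** Bose's triples are the columns {(i, 0), (i, 1), (i, 2)} and the sets {(i, k), (j, k), ((i + j) /
    2, k + 1)}. The last two branches recover the missing point when one given point is the
    midpoint. *)
Definition bose (u : nat) (h : 'Z_u) (p q : 'Z_u * 'Z_3) : 'Z_u * 'Z_3 :=
  if p.2 == q.2 then (h * (p.1 + q.1), p.2 + 1)
  else if p.1 == q.1 then (p.1, - (p.2 + q.2))
  else if q.2 == p.2 + 1 then (q.1 + q.1 - p.1, p.2)
  else (p.1 + p.1 - q.1, q.2).

Lemma bose_steiner u (h : 'Z_u) : h + h = 1 -> steiner_op (bose h).
Proof.
move=> hh.
have dbl (i j : 'Z_u) : i + i = j + j -> i = j.
  move=> E; have : h * (i + i) = h * (j + j) by rewrite E.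
  by rewrite !mulrDr -!mulrDl hh !mul1r.
have mid2 (i j : 'Z_u) : h * (i + j) + h * (i + j) = i + j.
  by rewrite -mulrDl hh mul1r.
have mid (i j : 'Z_u) : i != j -> i != h * (i + j).
  by apply: contraNneq => E; apply/eqP/(addrI i); rewrite -[RHS]mid2 -E.
have refl (i j : 'Z_u) : i != j -> i != j + j - i.
  by apply: contraNneq => E; apply/eqP/dbl; rewrite {1}E subrK.
have row i j k : bose h (i, k) (j, k) = (h * (i + j), k + 1).
  by rewrite /bose eqxx.
have col i k l : k != l -> bose h (i, k) (i, l) = (i, - (k + l)).
  by rewrite /bose /= eqxx => /negPf ->.
have up i j k : i != j -> bose h (i, k) (j, k + 1) = (j + j - i, k).
  by rewrite /bose /= eqxx neq_succ => /negPf ->.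
have down i j k : i != j -> bose h (i, k + 1) (j, k) = (i + i - j, k).
  by rewrite /bose /= [k + 1 == k]eq_sym Zp3_succ2 !neq_succ => /negPf ->.
move=> [i k] [j l]; have [<-{j} neq|nij _] := eqVneq i j.
  have {neq} nkl : k != l by apply: contraNneq neq => ->.
  (* Equality would give [k + k + l = 0 = k + k + k], hence [l = k]. *)
  have nk : k != - (k + l).
    apply: contraNneq nkl => E; apply/eqP/(addrI k)/oppr_inj.
    by rewrite -E; apply/eqP; rewrite eqr_oppLR -addr_eq0 Zp3_triple.
  have nlk : l != k by rewrite eq_sym.
  rewrite (col i k l) // (col i l k) // xpair_eqE eqxx /=.
  split; [by rewrite addrC | by rewrite eq_sym |].
  by rewrite col // opprD opprK addrA addNr add0r.
have nji : j != i by rewrite eq_sym.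
case: (Zp3_cases k l) => ->.
- rewrite !row [j + i]addrC; split=> //.
    by rewrite xpair_eqE [k + 1 == k]eq_sym neq_succ andbF.
  by rewrite up ?mid // mid2 [i + j]addrC addrK.
- rewrite down // up //; split=> //.
    by rewrite xpair_eqE eqxx andbT eq_sym refl.
  by rewrite row [i + _]addrC subrK mulrDr -mulrDl hh mul1r.
- rewrite down // up //; split=> //.
    by rewrite xpair_eqE neq_succ andbF.
  rewrite down; first by rewrite opprB addrA addrAC subrr add0r.
  by rewrite eq_sym subr_eq; apply: contraNneq nij => /addrI ->.
Qed.

(** Any bijection will do: the shift fixes the first coordinate, so the system on the rows need not
    be cyclic. *)
Lemma steiner_op_can (T U : finType) (s : U -> U -> U) :
  #|T| = #|U| -> steiner_op s -> exists s' : T -> T -> T, steiner_op s'.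
Proof.
move=> eqTU st; have [f [g fK gK]] : exists f : T -> U, bijective f.
  exists (fun x => enum_val (cast_ord eqTU (enum_rank x))).
  exists (fun y => enum_val (cast_ord (esym eqTU) (enum_rank y))) => x.
    by rewrite enum_valK cast_ordK enum_rankK.
  by rewrite enum_valK cast_ordKV enum_rankK.
exists (fun x y => g (s (f x) (f y))) => x y neq.
have [|sC sN sK] := st (f x) (f y); first by rewrite (can_eq fK).
by rewrite sC gK sK fK -(can_eq fK) gK.
Qed.

(** Bose's construction applies since [n / 3] is odd; [n > 3] makes it exceed 1, so that
    ['Z_(n %/ 3)] has the right size. *)
Lemma steiner_op_exists n : (3 < n)%N -> n = 3 %[mod 6] ->
  exists s : 'Z_n -> 'Z_n -> 'Z_n, steiner_op s.
Proof.
move=> n_gt3 n6; have [h hh] : exists h : 'Z_(n %/ 3), h + h = 1.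
  by apply: half_Zp; lia.
apply: (steiner_op_can _ (bose_steiner hh)).
by rewrite card_prod !card_ord !Zp_cast //; lia.
Qed.

(** * Designs from third-point operations *)

Section Design.
Variables n m : nat.
Implicit Types p q r : point n m.

Definition compat p q : bool := (p != q) && ~~ contiguous2 p q.

Lemma contiguous2_irr p : contiguous2 p p = false.
Proof. by case: p => x a; rewrite /contiguous2 !xpair_eqE !neq_succ !andbF. Qed.

(** Contiguous points agree in one coordinate, so points differing in both are always compatible. *)
Lemma compatE p q : compat p q =
  if p.1 == q.1 then far (q.2 - p.2)
  else (p.2 != q.2) || far (q.1 - p.1).
Proof.
case: p q => [x a] [y b]; rewrite /compat /contiguous2 /far /= !xpair_eqE /=.
rewrite !subr_eq0 ![y - x == _]subr_eq ![b - a == _]subr_eq.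
rewrite ![1 + _]addrC ![-1 + _]addrC [y == x]eq_sym [b == a]eq_sym.
have [<-|nxy] := eqVneq x y; have [<-|nab] := eqVneq a b;
  rewrite ?neq_succ ?andbF ?andbT //=.
- by rewrite negb_or andbC.
- by rewrite orbF negb_or andbC.
Qed.

Variable T : point n m -> point n m -> point n m.
Hypothesis T_op : forall p q, compat p q ->
  [/\ T q p = T p q, compat p (T p q), T p (T p q) = q
    & T (shift2 p) (shift2 q) = shift2 (T p q)].

Let compat_sym p q : compat p q = compat q p.
Proof.
rewrite !compatE [q.1 == _]eq_sym [q.2 == _]eq_sym.
by rewrite -farN opprB -[far (q.1 - _)]farN opprB.
Qed.

Let compat_shift p q : compat (shift2 p) (shift2 q) = compat p q.
Proof. by rewrite !compatE /= (inj_eq (addIr _)) opprD addrACA subrr addr0. Qed.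

Let block p q : {set point n m} := [set p; q; T p q].

Let blocks : {set {set point n m}} :=
  [set B | [exists p, exists q, compat p q && (B == block p q)]].

Let block_in p q : compat p q -> block p q \in blocks.
Proof.
move=> pq; rewrite inE; apply/existsP; exists p; apply/existsP; exists q.
by rewrite pq /=.
Qed.

Let blocksP B :
  reflect (exists p q, compat p q /\ B = block p q) (B \in blocks).
Proof.
rewrite inE; apply: (iffP existsP) => [[p /existsP [q /andP [pq /eqP ->]]]|].
  by exists p, q.
by move=> [p [q [pq ->]]]; exists p; apply/existsP; exists q; rewrite pq /=.
Qed.

(** By symmetry and involutivity of [T], each of the six ordered pairs in a block regenerates it;
    hence two points share at most one block. *)
Let block_pair B p q : B \in blocks -> p \in B -> q \in B -> p != q ->
  compat p q /\ B = block p q.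
Proof.
move=> /blocksP [x [y [xy ->]]].
have [Tyx xz Txz _] := T_op xy.
have yx : compat y x by rewrite compat_sym.
have [_ yz Tyz _] := T_op yx; rewrite Tyx in yz Tyz.
have [Tzx _ _ _] := T_op xz; rewrite Txz in Tzx.
have [Tzy _ _ _] := T_op yz; rewrite Tyz in Tzy.
have [zx zy] : compat (T x y) x /\ compat (T x y) y.
  by rewrite !(compat_sym (T x y)).
rewrite !inE => /orP[/orP[]|] /eqP-> /orP[/orP[]|] /eqP->; rewrite ?eqxx // => _;
  split=> //; rewrite /block ?Tyx ?Txz ?Tyz ?Tzx ?Tzy;
  apply/setP=> w; rewrite !inE;
  by case: (w == x); case: (w == y); case: (w == T x y).
Qed.

Lemma BSEC2_of_op :
  exists BB : {set {set point n m}}, BSEC2 3 BB /\ semi_cyclic BB.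
Proof.
have nT p q : compat p q -> compat q (T p q).
  move=> pq; have [<- _ _ _] := T_op pq.
  by rewrite compat_sym in pq; case: (T_op pq).
exists blocks; split; first split.
- move=> B /blocksP [p [q [pq ->]]].
  have [_ /andP[n1 _] _ _] := T_op pq; have /andP[n2 _] := nT _ _ pq.
  case/andP: pq => n3 _.
  by rewrite /block -setUA !cardsU1 cards1 !inE negb_or n1 n2 n3.
- move=> p q pq B BB [pB qB].
  have [E|neq] := eqVneq p q.
    by rewrite E contiguous2_irr in pq.
  by have [/andP[_ /negP]] := block_pair BB pB qB neq.
- move=> p q neq npq; have pq : compat p q by rewrite /compat neq.
  exists (block p q); split.
    by rewrite block_in // !inE !eqxx orbT.
  by move=> B [BB pB qB]; have [_ ->] := block_pair BB pB qB neq.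
have inj : injective (@shift2 n m).
  move=> [x a] [y b] E; congr pair; first exact: (congr1 fst E).
  exact: addIr (congr1 snd E).
(* The shift is injective on blocks, so one inclusion gives equality. *)
apply/eqP; rewrite eqEcard card_imset ?leqnn ?andbT; last exact: imset_inj.
apply/subsetP=> _ /imsetP [B /blocksP [p [q [pq ->]]] ->].
have [_ _ _ E] := T_op pq.
have -> : [set shift2 r | r in block p q] = block (shift2 p) (shift2 q).
  by rewrite /block !imsetU !imset_set1 E.
by apply: block_in; rewrite compat_shift.
Qed.
End Design.

(** * The third-point operation *)

Section Third.
Variables (n m : nat) (fn : 'Z_n -> 'Z_n) (fm : 'Z_m -> 'Z_m).
Variables (s : 'Z_n -> 'Z_n -> 'Z_n) (h : 'Z_m).
Hypotheses (fn_third : cyclic_third fn) (fm_third : cyclic_third fm).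
Hypotheses (s_op : steiner_op s) (hh : h + h = 1).

(* The heights form an arithmetic progression whose midpoint is the height of
   the point in the row with the largest label. *)
Definition height (x y : 'Z_n) (a b : 'Z_m) : 'Z_m :=
  let z := s x y in
  if (x < z)%N && (y < z)%N then h * (a + b)
  else if (y < x)%N && (z < x)%N then a + a - b
  else b + b - a.

(** The row of the midpoint depends only on the unordered triple of rows, so any two of the three
    points determine the same progression. There is one case for each position of the largest
    label. *)
Lemma heightP (x y : 'Z_n) (a b : 'Z_m) : x != y -> a != b ->
  [/\ height y x b a = height x y a b, height x y a b != a,
      height x (s x y) a (height x y a b) = b
    & height x y (a + 1) (b + 1) = height x y a b + 1].
Proof.
move=> nxy nab; have [sC sN sK] := s_op nxy.
have sN' : s x y != y.
  by rewrite -sC; have [|_ ->] := s_op (x := y) (y := x); rewrite // eq_sym.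
have h2 c : h * c + h * c = c by rewrite -mulrDl hh mul1r.
have hD c : h * (c + c) = c by rewrite mulrDr h2.
have x_max : [/\ a + a - b = a + a - b, a + a - b != a, a + a - (a + a - b) = b
    & a + 1 + (a + 1) - (b + 1) = a + a - b + 1].
  split=> //; [|by ring|by ring].
  by rewrite -addrA -subr_eq0 addrAC subrr add0r subr_eq0.
have y_max : [/\ b + b - a = b + b - a, b + b - a != a,
    h * (a + (b + b - a)) = b
    & b + 1 + (b + 1) - (a + 1) = b + b - a + 1].
  split=> //; [|by rewrite addrC subrK|by ring].
  rewrite subr_eq; apply: contraNneq nab => E.
  by rewrite -(hD a) -(hD b) E.
have z_max : [/\ h * (a + b) = h * (a + b), h * (a + b) != a,
    h * (a + b) + h * (a + b) - a = b
    & h * (a + 1 + (b + 1)) = h * (a + b) + 1].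
  split=> //; [|by rewrite h2; ring|by rewrite addrACA mulrDr hD].
  by apply: contraNneq nab => E; apply/eqP/(addrI a); rewrite -[RHS]h2 E.
rewrite /height sK sC [b + a]addrC.
have [nn1 nn2 nn3] : [/\ nat_of_ord x <> y, nat_of_ord (s x y) <> x
    & nat_of_ord (s x y) <> y].
  by split=> /ord_inj/eqP; apply/negP.
move: (s x y) sN sN' nn2 nn3 {sC sK} => z _ _ nn2 nn3.
have [lt_yx|lt_xy|//] := ltngtP y x; have [lt_zx|lt_xz|//] := ltngtP z x;
  have [lt_zy|lt_yz|//] := ltngtP z y => //=; lia.
Qed.

Definition third (p q : point n m) : point n m :=
  if p.1 == q.1 then (p.1, p.2 + fm (q.2 - p.2))
  else if p.2 == q.2 then (p.1 + fn (q.1 - p.1), p.2)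
  else (s p.1 q.1, height p.1 q.1 p.2 q.2).

(** Replacing [q] by the third point stays within the same clause of [third], so the three clauses
    are checked separately. *)
Lemma third_op p q : compat p q ->
  [/\ third q p = third p q, compat p (third p q), third p (third p q) = q
    & third (shift2 p) (shift2 q) = shift2 (third p q)].
Proof.
have addKl v (c d : 'Z_v) : c + d - c = d by ring.
have far0 v : far (0 : 'Z_v) = false by rewrite /far eqxx.
case: p q => [x a] [y b]; rewrite compatE /third /=.
have [<-{y} ab|nxy] := eqVneq x y.
  have [f1 f2 f3] := fm_third ab.
  rewrite !eqxx /= compatE /= eqxx addKl f2 -(opprB b a) f3.
  split=> //; rewrite /shift2 /=; congr pair; try ring.
  by rewrite (_ : b + 1 - (a + 1) = b - a); ring.
have [<-{b} /= xy|nab _] := eqVneq a b.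
  have [f1 f2 f3] := fn_third xy.
  have nx : x != x + fn (y - x).
    rewrite -subr_eq0 opprD addrA subrr add0r oppr_eq0.
    by apply: contraTneq f1 => ->; rewrite far0.
  rewrite !eqxx (negPf nx) compatE /= (negPf nx) !eqxx addKl f2 -(opprB y x) f3.
  by split=> //; congr pair; ring.
have [sC sN sK] := s_op nxy; have [h1 h2 h3 h4] := heightP nxy nab.
rewrite (eq_sym x (s _ _)) (negPf sN) (eq_sym a (height _ _ _ _)) (negPf h2).
rewrite compatE /= (eq_sym x (s _ _)) (negPf sN) (eq_sym a (height _ _ _ _)) h2.
by rewrite (inj_eq (addIr _)) (negPf nab) h1 h3 h4 sC sK.
Qed.
End Third.

Lemma cyclic_third_mod6 v : (9 <= v)%N -> v = 3 %[mod 6] ->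
  exists f : 'Z_v -> 'Z_v, cyclic_third f.
Proof.
move=> v_ge9 v6; have [t [t_gt0 ->]] : exists t, (0 < t)%N /\ v = (6 * t + 3)%N.
  by exists (v %/ 6)%N; lia.
by have [L LL] := langford_like_exists t_gt0; apply: cyclic_third_exists LL.
Qed.

Local Close Scope ring_scope.

Theorem theorem5p3 (m n : nat) (hm : 9 <= m) (hn : 9 <= n)
  (hm6 : m = 3 %[mod 6]) (hn6 : n = 3 %[mod 6]) :
  exists BB : {set {set point n m}}, BSEC2 3 BB /\ semi_cyclic BB.
Proof.
have [fn fn_third] := cyclic_third_mod6 hn hn6.
have [fm fm_third] := cyclic_third_mod6 hm hm6.
have [s s_op] : exists s : 'Z_n -> 'Z_n -> 'Z_n, steiner_op s.
  by apply: steiner_op_exists => //; lia.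
have [h hh] : exists h : 'Z_m, (h + h = 1)%R by apply: half_Zp; lia.
exact: BSEC2_of_op (third_op fn_third fm_third s_op hh).
Qed.
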